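(* Let $\Lambda$ be a G-semisimple algebra. Then $\Lambda$ is CM-finite.
   Context: $\Lambda$ is an Artin algebra, modules are finitely generated right modules, and $\mathrm{mod}\text{-}\Lambda$ is the category of such modules. A module is Gorenstein projective if it is a syzygy of an acyclic complex $\mathbf{P}^\bullet$ of projective modules such that $\mathrm{Hom}_\Lambda(\mathbf{P}^\bullet,Q)$ is acyclic for every projective module $Q$. $\mathrm{Gprj}\text{-}\Lambda$ is the category of Gorenstein projective modules and $\underline{\mathrm{Gprj}}\text{-}\Lambda$ its stable category modulo projectives. Standing assumption: $\mathrm{Gprj}\text{-}\Lambda$ is contravariantly finite in $\mathrm{mod}\text{-}\Lambda$. For an additive category $\mathcal{X}$, $\mathrm{mod}\text{-}\mathcal{X}$ denotes the category of finitely presented contravariant additive functors from $\mathcal{X}$ to abelian groups. $\Lambda$ is G-semisimple if $\mathrm{mod}\text{-}(\underline{\mathrm{Gprj}}\text{-}\Lambda)$ is a semisimple abelian category, i.e. all its objects are projective. $\Lambda$ is CM-finite if there are only finitely many isomorphism classes of indecomposable finitely generated Gorenstein projective $\Lambda$-modules. *)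

(* Defs.v *)
From HB Require Import structures.
From mathcomp Require Import all_boot all_order all_algebra.
From mathcomp Require Import boolp.

Set Implicit Arguments.
Unset Strict Implicit.
Unset Printing Implicit Defensive.

Import GRing.Theory.

Local Open Scope ring_scope.
Local Open Scope quotient_scope.

(* Descending chain condition on ideals.  Ideals are boolean predicates; with
   the classical axioms of boolp this covers all subsets of k. *)
Definition artinian (k : comPzRingType) : Prop :=
  forall I : nat -> {pred k^o},
    (forall n, submod_closed (I n)) ->
    (forall n, {subset I n.+1 <= I n}) ->
    exists n, forall m, (n <= m)%N -> I m =i I n.

(* The algebra structure is a central ring morphism k -> L rather than an
   [algType k], since the latter excludes the zero ring. *)
Definition artin_algebra (L : pzRingType) : Prop :=
  exists (k : comPzRingType) (phi : {rmorphism k -> L}),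
    [/\ artinian k,
        forall (a : k) (x : L), phi a * x = x * phi a &
        exists (n : nat) (g : 'I_n -> L), forall x : L,
          exists c : 'I_n -> k, x = \sum_i phi (c i) * g i].

(* Right L-modules are left modules over the opposite ring: [a *: x] stands
   for x a. *)
Notation rmodType L := (lmodType L^c).

Definition surj (A B : Type) (f : A -> B) : Prop :=
  forall y, exists x, f x = y.

Definition fin_gen (L : pzRingType) (M : rmodType L) : Prop :=
  exists (n : nat) (g : 'I_n -> M), forall x : M,
    exists c : 'I_n -> L^c, x = \sum_i c i *: g i.

Definition projective (L : pzRingType) (P : rmodType L) : Prop :=
  forall (N N' : rmodType L) (g : {linear N -> N'}) (h : {linear P -> N'}),
    surj g -> exists l : {linear P -> N}, forall x, g (l x) = h x.

Definition fg_projective (L : pzRingType) (P : rmodType L) : Prop :=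
  fin_gen P /\ projective P.

Definition isomorphic (L : pzRingType) (M N : rmodType L) : Prop :=
  exists f : {linear M -> N}, bijective f.

Definition acyclic (L : pzRingType) (P : int -> rmodType L)
    (d : forall i : int, {linear P i -> P (i + 1)}) : Prop :=
  forall i : int,
    (forall x, d (i + 1) (d i x) = 0) /\
    (forall y, d (i + 1) y = 0 -> exists x, d i x = y).

(* Exactness of Hom(P (i+2), Q) -> Hom(P (i+1), Q) -> Hom(P i, Q) for all i;
   that consecutive maps compose to zero is inherited from d. *)
Definition Hom_acyclic (L : pzRingType) (P : int -> rmodType L)
    (d : forall i : int, {linear P i -> P (i + 1)}) (Q : rmodType L) : Prop :=
  forall (i : int) (f : {linear P (i + 1) -> Q}),
    (forall x, f (d i x) = 0) ->
    exists g : {linear P (i + 1 + 1) -> Q}, forall x, f x = g (d (i + 1) x).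

Definition Gorenstein_projective (L : pzRingType) (M : rmodType L) : Prop :=
  fin_gen M /\
  exists (P : int -> rmodType L) (d : forall i : int, {linear P i -> P (i + 1)}),
    [/\ forall i, fg_projective (P i),
        acyclic d,
        forall Q : rmodType L, fg_projective Q -> Hom_acyclic d Q &
        exists (i : int) (iota : {linear M -> P i}),
          injective iota /\ forall y, d i y = 0 <-> exists x, iota x = y].

Record Gprj (L : pzRingType) := MkGprj {
  Gprj_mod :> rmodType L;
  Gprj_prop : Gorenstein_projective Gprj_mod
}.

(* Contravariant finiteness in mod-L: every finitely generated module has a
   right approximation by C. *)
Definition contravariantly_finite (L : pzRingType)
    (C : rmodType L -> Prop) : Prop :=
  forall M : rmodType L, fin_gen M ->
    exists (X : rmodType L) (f : {linear X -> M}), C X /\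
      forall (X' : rmodType L) (g : {linear X' -> M}), C X' ->
        exists h : {linear X' -> X}, forall x, g x = f (h x).

Definition indecomposable (L : pzRingType) (M : rmodType L) : Prop :=
  (exists x : M, x <> 0) /\
  forall A B : rmodType L, isomorphic M (A * B)%type ->
    (forall a : A, a = 0) \/ (forall b : B, b = 0).

Definition CM_finite (L : pzRingType) : Prop :=
  exists (n : nat) (G : 'I_n -> Gprj L),
    forall M : rmodType L, Gorenstein_projective M -> indecomposable M ->
      exists i, isomorphic M (G i).

Record preadditive := MkPreadditive {
  Obj :> Type;
  Mor : Obj -> Obj -> zmodType;
  idm : forall X, Mor X X;
  cmp : forall X Y Z, Mor Y Z -> Mor X Y -> Mor X Z;
  cmp1m : forall X Y (f : Mor X Y), cmp (idm Y) f = f;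
  cmpm1 : forall X Y (f : Mor X Y), cmp f (idm X) = f;
  cmpA : forall W X Y Z (h : Mor Y Z) (g : Mor X Y) (f : Mor W X),
    cmp h (cmp g f) = cmp (cmp h g) f;
  cmpDl : forall X Y Z (g g' : Mor Y Z) (f : Mor X Y),
    cmp (g + g') f = cmp g f + cmp g' f;
  cmpDr : forall X Y Z (g : Mor Y Z) (f f' : Mor X Y),
    cmp g (f + f') = cmp g f + cmp g f'
}.

Record cofunctor (X : preadditive) := MkCofunctor {
  fobj :> X -> zmodType;
  fmap : forall x y : X, Mor x y -> {additive fobj y -> fobj x};
  fmap1 : forall (x : X) a, fmap (idm x) a = a;
  fmap_cmp : forall (x y z : X) (g : Mor y z) (f : Mor x y) a,
    fmap (cmp g f) a = fmap f (fmap g a);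
  fmapD : forall (x y : X) (f g : Mor x y) a,
    fmap (f + g) a = fmap f a + fmap g a
}.

Record nattrans (X : preadditive) (F G : cofunctor X) := MkNattrans {
  ntrans :> forall x : X, {additive F x -> G x};
  ntrans_natural : forall (x y : X) (f : Mor x y) a,
    ntrans x (fmap F f a) = fmap G f (ntrans y a)
}.

Section Yoneda.
Context (X : preadditive) (y : X).

Definition precomp (x x' : X) (f : Mor x x') (a : Mor x' y) : Mor x y :=
  cmp a f.

Lemma precomp_is_zmod_morphism x x' (f : Mor x x') :
  zmod_morphism (precomp f).
Proof.
move=> a b; apply/eqP; rewrite /precomp eq_sym subr_eq -cmpDl.
by rewrite -addrA addNr addr0.
Qed.

HB.instance Definition _ x x' (f : Mor x x') :=
  GRing.isZmodMorphism.Build (Mor x' y) (Mor x y) (precomp f)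
    (precomp_is_zmod_morphism f).

Definition representable : cofunctor X :=
  @MkCofunctor X (fun x => Mor x y)
    (fun x x' f => precomp f : {additive Mor x' y -> Mor x y})
    (fun x a => cmpm1 a) (fun x x' z g f a => cmpA a g f)
    (fun x x' f g a => cmpDr a f g).

End Yoneda.

Definition fin_presented (X : preadditive) (F : cofunctor X) : Prop :=
  exists (x y : X) (a : nattrans (representable x) (representable y))
    (p : nattrans (representable y) F),
    forall z : X, surj (p z) /\
      forall b, p z b = 0 <-> exists c, a z c = b.

(* Epimorphisms and projective objects in the full subcategory mod-X of
   finitely presented functors; equality of natural transformations is
   componentwise. *)
Definition epi_mod (X : preadditive) (F G : cofunctor X)
    (e : nattrans F G) : Prop :=
  forall (H : cofunctor X) (u v : nattrans G H), fin_presented H ->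
    (forall x a, u x (e x a) = v x (e x a)) -> forall x, u x =1 v x.

Definition projective_mod (X : preadditive) (P : cofunctor X) : Prop :=
  forall (F G : cofunctor X) (e : nattrans F G) (u : nattrans P G),
    fin_presented F -> fin_presented G -> epi_mod e ->
    exists w : nattrans P F, forall x a, e x (w x a) = u x a.

Definition semisimple_mod (X : preadditive) : Prop :=
  forall F : cofunctor X, fin_presented F -> projective_mod F.

Section ModuleHom.
Context (L : pzRingType).
Implicit Types M N : rmodType L.

Definition mhom M N := {linear M -> N}.
Definition mhom_fun M N (f : mhom M N) : M -> N := f.

Section ZmodMhom.
Context (M N : rmodType L).

Lemma mhomP (f g : mhom M N) : mhom_fun f =1 mhom_fun g -> f = g.
Proof.
move=> /funext; case: f => f [[a1] [b1]]; case: g => g [[a2] [b2]].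
rewrite /mhom_fun /= => E; case: _ / E in a2 b2 *.
by rewrite (Prop_irrelevance a1 a2) (Prop_irrelevance b1 b2).
Qed.

HB.instance Definition _ := gen_eqMixin (mhom M N).
HB.instance Definition _ := gen_choiceMixin (mhom M N).

Definition mhom0 : mhom M N := \0 : {linear M -> N}.
Definition mhom_opp (f : mhom M N) : mhom M N :=
  (\- (f : {linear M -> N})) : {linear M -> N}.
Definition mhom_add (f g : mhom M N) : mhom M N :=
  ((f : {linear M -> N}) \+ (g : {linear M -> N})) : {linear M -> N}.

Lemma mhom_addA : associative mhom_add.
Proof. by move=> f g h; apply: mhomP => x; exact: addrA. Qed.
Lemma mhom_addC : commutative mhom_add.
Proof. by move=> f g; apply: mhomP => x; exact: addrC. Qed.
Lemma mhom_add0 : left_id mhom0 mhom_add.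
Proof. by move=> f; apply: mhomP => x; exact: add0r. Qed.
Lemma mhom_addN : left_inverse mhom0 mhom_opp mhom_add.
Proof. by move=> f; apply: mhomP => x; exact: addNr. Qed.

HB.instance Definition _ := GRing.isZmodule.Build (mhom M N)
  mhom_addA mhom_addC mhom_add0 mhom_addN.

End ZmodMhom.

Definition mhom_id M : mhom M M := idfun : {linear M -> M}.
Definition mhom_comp M N K (g : mhom N K) (f : mhom M N) : mhom M K :=
  ((g : {linear N -> K}) \o (f : {linear M -> N})) : {linear M -> K}.

Definition factors_proj M N (f : mhom M N) : Prop :=
  exists (P : rmodType L) (g : mhom M P) (h : mhom P N),
    fg_projective P /\ f = mhom_comp h g.

Definition proj_maps M N : {pred mhom M N} := fun f => `[< factors_proj f >].
Arguments proj_maps : clear implicits.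

Lemma proj_mapsP M N (f : mhom M N) :
  reflect (factors_proj f) (f \in proj_maps M N).
Proof. exact: asboolP. Qed.

Lemma fg_projective0 : fg_projective ('rV[L^c]_0 : rmodType L).
Proof.
split.
  by exists 0%N, (fun=> 0) => x; exists (fun=> 0); rewrite big_ord0 thinmx0.
move=> N N' g h _; exists (\0 : {linear _ -> _}) => x.
by rewrite (thinmx0 x) !linear0.
Qed.

Lemma fg_projective_prod (P Q : rmodType L) :
  fg_projective P -> fg_projective Q -> fg_projective (P * Q)%type.
Proof.
move=> [[n [g gP]] pP] [[m [k kP]] pQ]; split.
  exists (n + m)%N, (fun i => match split i with
    | inl j => (g j, 0) | inr j => (0, k j) end) => -[x y].
  have [c ->] := gP x; have [c' ->] := kP y.
  exists (fun i => match split i with inl j => c j | inr j => c' j end).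
  rewrite big_split_ord /=.
  have sl i : split (lshift m i) = inl i := unsplitK (inl i).
  have sr i : split (rshift n i) = inr i := unsplitK (inr i).
  under [X in _ = X + _]eq_bigr => i _ do rewrite sl.
  under [X in _ = _ + X]eq_bigr => i _ do rewrite sr.
  rewrite [LHS]surjective_pairing [RHS]surjective_pairing /=.
  rewrite !(raddf_sum fst) !(raddf_sum snd) /=.
  rewrite [X in _ = (_ + X, _)]big1 ?[X in _ = (_, X + _)]big1 ?addr0 ?add0r //.
    by move=> i _; rewrite scaler0.
  by move=> i _; rewrite scaler0.
move=> N N' f h sf.
pose i1 (x : P) : P * Q := (x, 0).
pose i2 (y : Q) : P * Q := (0, y).
have l1 : linear i1.
  by move=> a u v; congr (_, _); rewrite /= ?scaler0 ?addr0.
have l2 : linear i2.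
  by move=> a u v; congr (_, _); rewrite /= ?scaler0 ?addr0.
pose j1 : {linear P -> (P * Q)%type} :=
  HB.pack i1 (GRing.isLinear.Build _ _ _ _ i1 l1).
pose j2 : {linear Q -> (P * Q)%type} :=
  HB.pack i2 (GRing.isLinear.Build _ _ _ _ i2 l2).
have [a aP] := pP _ _ f (h \o j1 : {linear P -> N'}) sf.
have [b bP] := pQ _ _ f (h \o j2 : {linear Q -> N'}) sf.
exists ((a \o fst) \+ (b \o snd) : {linear (P * Q)%type -> N}) => -[x y] /=.
rewrite linearD aP bP /= -linearD; congr (h _).
by congr (_, _); rewrite /= ?addr0 ?add0r.
Qed.

Lemma proj_maps_closed M N : zmod_closed (proj_maps M N).
Proof.
split.
  apply/proj_mapsP; exists 'rV[L^c]_0, 0, 0; split; first exact: fg_projective0.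
  exact: mhomP.
move=> _ _ /proj_mapsP[P [g [h [pP ->]]]] /proj_mapsP[Q [g' [h' [pQ ->]]]].
apply/proj_mapsP.
have lg : linear (fun x : M => (mhom_fun g x, mhom_fun g' x) : P * Q).
  by move=> a u v; congr (_, _); exact: linearP.
pose gg : {linear M -> (P * Q)%type} :=
  HB.pack (fun x : M => (mhom_fun g x, mhom_fun g' x) : P * Q)
    (GRing.isLinear.Build _ _ _ _ _ lg).
pose hh : {linear (P * Q)%type -> N} :=
  ((h : {linear P -> N}) \o fst) \- ((h' : {linear Q -> N}) \o snd).
exists (P * Q)%type, gg, hh; split; first exact: fg_projective_prod.
exact: mhomP.
Qed.

HB.instance Definition _ M N :=
  GRing.isZmodClosed.Build (mhom M N) (proj_maps M N) (proj_maps_closed M N).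

Definition shom M N : zmodType := {ideal_quot (proj_maps M N)}.

(* The class of a linear map in the stable Hom group. *)
Definition stab M N (f : mhom M N) : shom M N :=
  \pi_{ideal_quot (proj_maps M N)} f.
Definition unstab M N (f : shom M N) : mhom M N :=
  repr (f : {ideal_quot (proj_maps M N)}).

Definition shom_id M : shom M M := stab (mhom_id M).
Definition shom_comp M N K (g : shom N K) (f : shom M N) : shom M K :=
  stab (mhom_comp (unstab g) (unstab f)).

End ModuleHom.

Arguments proj_maps {L} M N.

Section StableCategory.
Context (L : pzRingType).
Implicit Types M N K : rmodType L.

Lemma mhom_compDl M N K (g g' : mhom N K) (f : mhom M N) :
  mhom_comp (g + g') f = mhom_comp g f + mhom_comp g' f.
Proof. exact: mhomP. Qed.

Lemma mhom_compDr M N K (g : mhom N K) (f f' : mhom M N) :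
  mhom_comp g (f + f') = mhom_comp g f + mhom_comp g f'.
Proof. by apply: mhomP => x; exact: (linearD (g : {linear N -> K})). Qed.

Lemma mhom_compBl M N K (g g' : mhom N K) (f : mhom M N) :
  mhom_comp (g - g') f = mhom_comp g f - mhom_comp g' f.
Proof. exact: mhomP. Qed.

Lemma mhom_compBr M N K (g : mhom N K) (f f' : mhom M N) :
  mhom_comp g (f - f') = mhom_comp g f - mhom_comp g f'.
Proof. by apply: mhomP => x; exact: (linearB (g : {linear N -> K})). Qed.

Lemma proj_maps_compl M N K (g : mhom N K) (f : mhom M N) :
  f \in proj_maps M N -> mhom_comp g f \in proj_maps M K.
Proof.
move=> /proj_mapsP[P [a [b [pP ->]]]]; apply/proj_mapsP.
by exists P, a, (mhom_comp g b); split => //; exact: mhomP.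
Qed.

Lemma proj_maps_compr M N K (g : mhom N K) (f : mhom M N) :
  g \in proj_maps N K -> mhom_comp g f \in proj_maps M K.
Proof.
move=> /proj_mapsP[P [a [b [pP ->]]]]; apply/proj_mapsP.
by exists P, (mhom_comp a f), b; split => //; exact: mhomP.
Qed.

Lemma unstabK M N (f : shom M N) : stab (unstab f) = f.
Proof. exact: reprK. Qed.

Lemma stabP M N (f g : mhom M N) :
  reflect (stab f = stab g) (f - g \in proj_maps M N).
Proof. by rewrite Quotient.idealrBE; exact: eqP. Qed.

Lemma shom_comp_stab M N K (g : mhom N K) (f : mhom M N) :
  shom_comp (stab g) (stab f) = stab (mhom_comp g f).
Proof.
rewrite /shom_comp; apply/stabP.
set g' := unstab _; set f' := unstab _.
have Dg : g' - g \in proj_maps N K by apply/stabP; rewrite unstabK.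
have Df : f' - f \in proj_maps M N by apply/stabP; rewrite unstabK.
rewrite -[mhom_comp g' f'](subrK (mhom_comp g' f)) -addrA.
rewrite -mhom_compBr -mhom_compBl rpredD //.
  exact: proj_maps_compl.
exact: proj_maps_compr.
Qed.

Lemma stabD M N (f g : mhom M N) : stab (f + g) = stab f + stab g.
Proof. by rewrite /stab piE. Qed.

Lemma shom_comp1m M N (f : shom M N) : shom_comp (shom_id N) f = f.
Proof.
rewrite -[f]unstabK shom_comp_stab; congr (stab _); exact: mhomP.
Qed.

Lemma shom_compm1 M N (f : shom M N) : shom_comp f (shom_id M) = f.
Proof.
rewrite -[f]unstabK shom_comp_stab; congr (stab _); exact: mhomP.
Qed.

Lemma shom_compA M N K J (h : shom K J) (g : shom N K) (f : shom M N) :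
  shom_comp h (shom_comp g f) = shom_comp (shom_comp h g) f.
Proof.
rewrite -[h]unstabK -[g]unstabK -[f]unstabK !shom_comp_stab.
congr (stab _); exact: mhomP.
Qed.

Lemma shom_compDl M N K (g g' : shom N K) (f : shom M N) :
  shom_comp (g + g') f = shom_comp g f + shom_comp g' f.
Proof.
rewrite -[g]unstabK -[g']unstabK -[f]unstabK.
by rewrite -stabD !shom_comp_stab -stabD mhom_compDl.
Qed.

Lemma shom_compDr M N K (g : shom N K) (f f' : shom M N) :
  shom_comp g (f + f') = shom_comp g f + shom_comp g f'.
Proof.
rewrite -[g]unstabK -[f]unstabK -[f']unstabK.
by rewrite -stabD !shom_comp_stab -stabD mhom_compDr.
Qed.

Definition stable_Gprj : preadditive :=
  @MkPreadditive (Gprj L) (fun X Y => shom X Y) (fun X => shom_id X)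
    (fun X Y Z => @shom_comp L X Y Z)
    (fun X Y f => shom_comp1m f) (fun X Y f => shom_compm1 f)
    (fun W X Y Z h g f => shom_compA h g f)
    (fun X Y Z g g' f => shom_compDl g g' f)
    (fun X Y Z g f f' => shom_compDr g f f').

End StableCategory.

Arguments stable_Gprj : clear implicits.

Definition G_semisimple (L : pzRingType) : Prop :=
  semisimple_mod (stable_Gprj L).

(* Main.v *)
Require Import Defs.
From mathcomp Require Import all_boot all_algebra.
From HB Require Import structures.
From mathcomp Require Import boolp classical_sets.

Set Implicit Arguments.
Unset Strict Implicit.
Unset Printing Implicit Defensive.

Import GRing.Theory.

Local Open Scope ring_scope.
Local Open Scope quotient_scope.

(** Every indecomposable Gorenstein projective module G turns out to be a
    direct summand of one of finitely many fixed finitely generated modules: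
    the regular module, and the Gorenstein projective approximations of the
    simple modules, of which there are finitely many up to isomorphism.  By the
    Krull-Schmidt property each of these has finitely many indecomposable
    summands, so there are finitely many possible G.

    If G is projective, G and the regular module both map onto a simple
    quotient of G; lifting each map along the other gives an endomorphism of G
    that factors through the regular module and is not nilpotent, hence is
    bijective ([projective_summand_regular]).

    If G is not projective, its stable Hom functor does not vanish on all simple
    modules: take a minimal submodule A of G receiving from G a map that does
    not factor through a projective, and compose with a simple quotient of A
    ([nonprojective_map_to_simple]).  The resulting stably nonzero map G -> T
    factors as h : G -> X followed by the approximation X -> T, and h is
    stably nonzero.  Semisimplicity makes the stable category von Neumann
    regular: the cokernel of (-, h) is a projective functor, so the projection
    from (-, X) onto it splits, which by the Yoneda lemma amounts to some
    v : X -> G with h v h = h stably ([semisimple_mod_regular]).  Then h (v h)^n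
    is stably h for all n, so v h is not nilpotent, hence is bijective, and G is
    a summand of X ([Gprj_summand]).

    Both cases use the Fitting alternative [endo_bijective_or_nilpotent].  It
    needs the descending chain condition on submodules, inherited from the
    base ring ([fin_gen_artinian]), and, in place of the ascending one, the fact
    that a surjective endomorphism of a module finitely generated over a
    commutative ring is injective ([surjective_endo_injective]). *)

(** * Submodules, quotients and induced maps *)

Definition to_linear (R : pzRingType) (M N : lmodType R) (f : M -> N)
    (lf : linear f) : {linear M -> N} :=
  HB.pack f (GRing.isLinear.Build _ _ _ _ f lf).

(** Submodules are Prop-valued, which suits the chain-condition arguments; they
    are turned into modules only through [submodule_exists] and
    [quotient_exists]. *)
Definition submodule (R : pzRingType) (M : lmodType R) (P : M -> Prop) : Prop :=
  P 0 /\ forall a x y, P x -> P y -> P (a *: x + y).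

Definition mono_onto (R : pzRingType) (A M : lmodType R) (P : M -> Prop)
    (i : {linear A -> M}) : Prop :=
  injective i /\ forall x, P x <-> exists a, i a = x.

Section SubmoduleTypes.
Context (R : pzRingType) (M : lmodType R).

Definition submod_pred (P : {pred M}) (cP : submod_closed P) : {pred M} := P.
HB.instance Definition _ P (cP : submod_closed P) :=
  GRing.isSubmodClosed.Build R M (submod_pred cP) cP.

Context (P : {pred M}) (cP : submod_closed P).

Record submod_of := SubmodOf {
  submod_val : M;
  submod_valP : submod_val \in submod_pred cP
}.
HB.instance Definition _ := [isSub for submod_val].
HB.instance Definition _ := [Choice of submod_of by <:].
HB.instance Definition _ := [SubChoice_isSubLmodule of submod_of by <:].

Definition quot_mod := {ideal_quot (submod_pred cP)}.
HB.instance Definition _ := GRing.Zmodule.on quot_mod.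

Definition quot_proj (x : M) : quot_mod := \pi_{ideal_quot (submod_pred cP)} x.
Definition quot_repr (q : quot_mod) : M :=
  repr (q : {ideal_quot (submod_pred cP)}).

Lemma quot_reprK q : quot_proj (quot_repr q) = q.
Proof. exact: reprK. Qed.

Lemma quot_projP x y : quot_proj x = quot_proj y <-> x - y \in submod_pred cP.
Proof.
by rewrite Quotient.idealrBE; split=> [e|/eqP]; first exact/eqP.
Qed.

Lemma quot_projD x y : quot_proj (x + y) = quot_proj x + quot_proj y.
Proof. by rewrite /quot_proj piE. Qed.

Definition quot_scale (a : R) (q : quot_mod) := quot_proj (a *: quot_repr q).

Lemma quot_scale_proj a x : quot_scale a (quot_proj x) = quot_proj (a *: x).
Proof.
apply/quot_projP; rewrite -scalerBr rpredZ //.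
by apply/quot_projP; rewrite quot_reprK.
Qed.

Lemma quot_scaleA a b q : quot_scale a (quot_scale b q) = quot_scale (a * b) q.
Proof. by rewrite -[q]quot_reprK !quot_scale_proj scalerA. Qed.
Lemma quot_scale1 : left_id 1 quot_scale.
Proof. by move=> q; rewrite -[q]quot_reprK quot_scale_proj scale1r. Qed.
Lemma quot_scaleDr : right_distributive quot_scale +%R.
Proof.
move=> a q q'; rewrite -[q]quot_reprK -[q']quot_reprK -quot_projD.
by rewrite !quot_scale_proj -quot_projD scalerDr.
Qed.
Lemma quot_scaleDl q a b :
  quot_scale (a + b) q = quot_scale a q + quot_scale b q.
Proof.
by rewrite -[q]quot_reprK !quot_scale_proj -quot_projD scalerDl.
Qed.

HB.instance Definition _ := GRing.Zmodule_isLmodule.Build R quot_mod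
  quot_scaleA quot_scale1 quot_scaleDr quot_scaleDl.

Lemma quot_proj_linear : linear quot_proj.
Proof. by move=> a x y; rewrite quot_projD -quot_scale_proj. Qed.

End SubmoduleTypes.

Section InducedMaps.
Context (R : pzRingType).
Implicit Types M N A C Q : lmodType R.

Lemma submodule_exists M (P : M -> Prop) : submodule P ->
  exists (A : lmodType R) (i : {linear A -> M}), mono_onto P i.
Proof.
move=> [P0 PD]; have cP : submod_closed (fun x : M => `[< P x >]).
  split; first exact/asboolP.
  by move=> a x y /asboolP Px /asboolP Py; apply/asboolP/PD.
exists (submod_of cP), (val : {linear submod_of cP -> M}); split.
  exact: val_inj.
move=> x; split=> [Px|[[y yP] <-]]; last exact/asboolP.
have Px' : x \in submod_pred cP by exact/asboolP.
by exists (SubmodOf Px').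
Qed.

Lemma quotient_exists M (P : M -> Prop) : submodule P ->
  exists (Q : lmodType R) (p : {linear M -> Q}),
    surj p /\ forall x, p x = 0 <-> P x.
Proof.
move=> [P0 PD]; have cP : submod_closed (fun x : M => `[< P x >]).
  split; first exact/asboolP.
  by move=> a x y /asboolP Px /asboolP Py; apply/asboolP/PD.
pose p := to_linear (@quot_proj_linear R M _ cP).
exists (quot_mod cP), p; split.
  by move=> q; exists (quot_repr q); exact: quot_reprK.
move=> x; rewrite -(linear0 p); split=> [/quot_projP|Px].
  by rewrite subr0 => /asboolP.
by apply/quot_projP; rewrite subr0; exact/asboolP.
Qed.

Lemma lift_mono A M C (i : {linear A -> M}) (h : {linear C -> M}) :
  injective i -> (forall c, exists a, i a = h c) ->
  exists h' : {linear C -> A}, forall c, i (h' c) = h c.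
Proof.
move=> inj_i /choice[f fP].
have lf : linear f.
  by move=> a x y; apply: inj_i; rewrite linearP !fP linearP.
by exists (to_linear lf).
Qed.

Lemma factor_epi M Q C (p : {linear M -> Q}) (q : {linear M -> C}) :
  surj p -> (forall x, p x = 0 -> q x = 0) ->
  exists r : {linear Q -> C}, forall x, r (p x) = q x.
Proof.
move=> /choice[s sP] kpq.
have rP x : q (s (p x)) = q x.
  by apply/eqP; rewrite -subr_eq0 -linearB kpq // linearB sP subrr.
have lr : linear (fun y => q (s y)).
  by move=> a x y; rewrite -[in LHS](sP x) -[in LHS](sP y) -linearP rP linearP.
by exists (to_linear lr).
Qed.

Lemma kernel_submodule M N (f : {linear M -> N}) : submodule (fun x => f x = 0).
Proof.
by split=> [|a x y fx fy]; rewrite ?linear0 // linearP fx fy scaler0 addr0.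
Qed.

Lemma image_submodule M N (f : {linear M -> N}) :
  submodule (fun y => exists x, f x = y).
Proof.
split=> [|a _ _ [x <-] [y <-]]; first by exists 0; rewrite linear0.
by exists (a *: x + y); rewrite linearP.
Qed.

Lemma kernel0_inj M N (f : {linear M -> N}) :
  (forall x, f x = 0 -> x = 0) -> injective f.
Proof.
move=> kf x y e; apply/eqP; rewrite -subr_eq0.
by rewrite (kf (x - y)) // linearB e subrr.
Qed.

Lemma inj_surj_bij A B (f : A -> B) : injective f -> surj f -> bijective f.
Proof.
by move=> inj_f /choice[g gP]; exists g => // x; apply: inj_f; rewrite gP.
Qed.

Lemma linear_inverse M N (f : {linear M -> N}) : bijective f ->
  exists g : {linear N -> M}, cancel f g /\ cancel g f.
Proof.
case=> g fK gK; have lg : linear g.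
  by move=> a x y; rewrite -[in LHS](gK x) -[in LHS](gK y) -linearP fK.
by exists (to_linear lg).
Qed.

Lemma mono_image M N (f : {linear M -> N}) :
  exists (A : lmodType R) (i : {linear A -> N}) (g : {linear M -> A}),
    [/\ injective i, surj g & forall x, i (g x) = f x].
Proof.
have [A [i [inj_i iP]]] := submodule_exists (image_submodule f).
have [|g gP] := lift_mono inj_i (h := f).
  by move=> x; apply/iP; exists x.
exists A, i, g; split=> // a.
have /iP [x xP] : exists a', i a' = i a by exists a.
by exists x; apply: inj_i; rewrite gP.
Qed.

Lemma iter_linear M (f : {linear M -> M}) n :
  exists g : {linear M -> M}, forall x, g x = iter n f x.
Proof.
elim: n => [|n [g gP]]; first by exists (idfun : {linear M -> M}).
by exists (f \o g : {linear M -> M}) => x /=; rewrite gP.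
Qed.

End InducedMaps.

Section FinGen.
Context (L : pzRingType).
Implicit Types M N A B : rmodType L.

Lemma fin_gen_surj M N (f : {linear M -> N}) :
  fin_gen M -> surj f -> fin_gen N.
Proof.
move=> [n [g gP]] sf; exists n, (f \o g) => y.
have [x <-] := sf y; have [c ->] := gP x; exists c.
by rewrite linear_sum; apply: eq_bigr => i _; rewrite linearZ.
Qed.

Lemma isomorphic_sym M N : isomorphic M N -> isomorphic N M.
Proof.
by move=> [f /linear_inverse[g [fK gK]]]; exists g; exists f.
Qed.

Lemma isomorphic_trans M N K :
  isomorphic M N -> isomorphic N K -> isomorphic M K.
Proof.
move=> [f bf] [g bg]; exists (g \o f : {linear M -> K}); exact: bij_comp.
Qed.

Lemma direct_sum_iso M A B (i : {linear A -> M}) (j : {linear B -> M}) :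
    injective i -> injective j ->
    (forall a b, i a = j b -> a = 0) ->
    (forall x, exists a b, x = i a + j b) ->
  isomorphic M (A * B)%type.
Proof.
move=> inj_i inj_j disj span; apply: isomorphic_sym.
exists ((i \o fst) \+ (j \o snd) : {linear (A * B)%type -> M}).
apply: inj_surj_bij => [|x]; last first.
  by have [a [b ->]] := span x; exists (a, b).
apply: kernel0_inj => -[a b] /= e.
have a0 : a = 0.
  apply: (disj a (- b)); rewrite linearN; apply/eqP.
  by rewrite -subr_eq0 opprK e.
move: e; rewrite a0 linear0 add0r => e; congr (_, _).
by apply: inj_j; rewrite e linear0.
Qed.

End FinGen.

(** * Finiteness over an Artin algebra *)

Definition minimal_in (T : Type) (F : (T -> Prop) -> Prop) (P : T -> Prop) :=
  F P /\ forall Q, F Q -> (forall x, Q x -> P x) -> forall x, P x -> Q x.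

(** The minimal condition, equivalent to the descending chain condition by
    dependent choice. *)
Definition artinian_module (R : pzRingType) (M : lmodType R) : Prop :=
  forall F : (M -> Prop) -> Prop, (forall P, F P -> submodule P) ->
    (exists P, F P) -> exists P, minimal_in F P.

Lemma artinian_minimal (k : comPzRingType) :
  artinian k -> artinian_module (k^o : lmodType k).
Proof.
move=> dcc F subF [P0 FP0]; apply/not_existsP => noMin.
pose T := {P | F P}.
have step (P : T) : {Q : T | (forall x, sval Q x -> sval P x) /\
    exists x, sval P x /\ ~ sval Q x}.
  apply: cid; case: P => P FP /=; have := noMin P.
  move=> /not_andP[//|/existsNP[Q /not_implyP[FQ /not_implyP[QP]]]].
  move=> /existsNP[x /not_implyP[Px Qx]].
  by exists (exist _ Q FQ); split=> //; exists x.
have [f [_ fP]] := dependent_choice step (exist _ P0 FP0).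
have [||n nP] := dcc (fun n x => `[< sval (f n) x >]).
- move=> n; have [P0n PDn] := subF _ (svalP (f n)); split; first exact/asboolP.
  by move=> a x y /asboolP Px /asboolP Py; apply/asboolP/PDn.
- by move=> n x /asboolP xP; apply/asboolP; apply: (fP n).1.
have [x [Px Qx]] := (fP n).2; apply: Qx; apply/asboolP.
by have := nP n.+1 (leqnSn n) x; rewrite !unfold_in => ->; exact/asboolP.
Qed.

Section Span.
Context (R : pzRingType) (M : lmodType R).
Implicit Types (S : {linear M -> M} -> Prop) (gs : seq M).

(** Linear combinations of gs whose scalars are endomorphisms taken from S.  One
    notion thus serves both for the base ring and for the commutative ring of
    endomorphisms used in the proof of [surj_endo_inj]. *)
Fixpoint span S gs (x : M) : Prop :=
  if gs is g :: gs' then exists c, S c /\ span S gs' (x - c g) else x = 0.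

Definition scalar_set S : Prop :=
  S \0 /\ forall r s t, S r -> S s -> S t -> S ((r \o s) \+ t).

Lemma span_subset S S' gs x :
  (forall c, S c -> S' c) -> span S gs x -> span S' gs x.
Proof.
move=> SS'; elim: gs x => //= g gs IH x [c [Sc xP]].
by exists c; split; [exact: SS' | exact: IH].
Qed.

Lemma span0 S gs : scalar_set S -> span S gs 0.
Proof.
by move=> [S0 _]; elim: gs => //= g gs IH; exists \0; rewrite /= subr0.
Qed.

Lemma spanP S gs r x y : scalar_set S -> S r ->
  span S gs x -> span S gs y -> span S gs (r x + y).
Proof.
move=> [_ SD] Sr; elim: gs x y => [|g gs IH] x y /=.
  by move=> -> ->; rewrite linear0 addr0.
move=> [c [Sc xP]] [d [Sd yP]]; exists ((r \o c) \+ d); split; first exact: SD.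
by rewrite /= opprD addrACA -linearB; exact: IH.
Qed.

Lemma span_sum S (I : Type) (r : seq I) (c : I -> {linear M -> M})
    (g : I -> M) :
  (forall i, S (c i)) -> span S (map g r) (\sum_(i <- r) c i (g i)).
Proof.
move=> Sc; elim: r => [|i r IH] /=; first by rewrite big_nil.
by exists (c i); split=> //; rewrite big_cons addrC addKr.
Qed.

End Span.

Section ArtinAlgebra.
Context (L : pzRingType) (k : comPzRingType) (phi : {rmorphism k -> L}).
Hypothesis phi_central : forall (a : k) (x : L), phi a * x = x * phi a.

Section Module.
Context (M : rmodType L).
Implicit Types (x y g : M) (gs : seq M).

Lemma central_scale_linear a : linear (fun x : M => (phi a : L^c) *: x).
Proof.
move=> b x y; rewrite scalerDr !scalerA; congr (_ *: _ + _).
exact: esym (phi_central a b).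
Qed.

Definition central_scale a : {linear M -> M} :=
  to_linear (central_scale_linear a).

Definition base_scalar (c : {linear M -> M}) : Prop :=
  exists a, forall x, c x = central_scale a x.

Lemma base_scalar_set : scalar_set base_scalar.
Proof.
split; first by exists 0 => x; rewrite /= rmorph0 scale0r.
move=> r s t [a rP] [b sP] [c tP]; exists (a * b + c) => x /=.
rewrite rP sP tP /= rmorphD scalerDl scalerA; congr (_ *: _ + _).
by rewrite rmorphM; exact: phi_central.
Qed.

Lemma base_scalarE a : base_scalar (central_scale a).
Proof. by exists a. Qed.

Lemma fin_gen_base :
    (exists (n : nat) (g : 'I_n -> L), forall x : L,
       exists c : 'I_n -> k, x = \sum_i phi (c i) * g i) ->
    fin_gen M ->
  exists gs, forall x, span base_scalar gs x.
Proof.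
move=> [n [g /choice[c cP]]] [m [h hP]].
exists [seq (g p.2 : L^c) *: h p.1 | p <- index_enum ('I_m * 'I_n)%type] => x.
have [d ->] := hP x.
rewrite (_ : \sum_i _ =
  \sum_p central_scale (c (d p.1) p.2) ((g p.2 : L^c) *: h p.1)).
  by apply: span_sum => p; exact: base_scalarE.
rewrite -(pair_bigA _ (fun i j =>
  central_scale (c (d i) j) ((g j : L^c) *: h i))) /=.
apply: eq_bigr => i _; rewrite {1}(cP (d i)).
rewrite (@scaler_suml L^c M); apply: eq_bigr => j _.
by rewrite scalerA; congr (_ *: _); exact: phi_central.
Qed.

Definition base_submodule (P : M -> Prop) : Prop :=
  P 0 /\ forall a x y, P x -> P y -> P (central_scale a x + y).

Lemma base_submoduleB P x y : base_submodule P -> P x -> P y -> P (x - y).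
Proof.
move=> [_ PD] Px Py; have := PD (-1) y x Py Px.
by rewrite /= rmorphN1 scaleN1r addrC.
Qed.

(** A submodule P of a module spanned by g :: gs is controlled by the ideal of
    the possible coefficients of g in P together with the part of P spanned by
    gs.  Minimizing first the ideal, then that part, gives a minimal P. *)
Lemma base_minimal gs (F : (M -> Prop) -> Prop) : artinian k ->
    (forall P, F P -> base_submodule P) ->
    (forall P, F P -> forall x, P x -> span base_scalar gs x) ->
    (exists P, F P) ->
  exists P, minimal_in F P.
Proof.
move=> /artinian_minimal k_min.
elim: gs F => [|g gs IH] F subF spanF [P0 FP0].
  exists P0; split=> // Q FQ _ x /(spanF _ FP0) /= ->.
  by case: (subF Q FQ).
pose coef (P : M -> Prop) (a : k) :=
  exists x, P x /\ span base_scalar gs (x - central_scale a g).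
have coef_sub P : F P -> submodule (coef P : k^o -> Prop).
  move=> /subF [P0' PD]; split.
    exists 0; split=> //; rewrite /= rmorph0 scale0r subr0.
    exact: span0 base_scalar_set.
  move=> a b c [x [Px xP]] [y [Py yP]]; exists (central_scale a x + y).
  split; first exact: PD.
  have := spanP base_scalar_set (base_scalarE a) xP yP.
  rewrite linearB addrACA -opprD; congr (span _ _ (_ - _)).
  rewrite /= rmorphD scalerDl scalerA; congr (_ *: _ + _).
  by rewrite rmorphM; exact: esym (phi_central _ _).
have [||I [[P1 [FP1 IE]] Imin]] := k_min (fun I => exists P, F P /\ I = coef P).
- by move=> _ [P [FP ->]]; exact: coef_sub.
- by exists (coef P0), P0.
pose below P x := P x /\ span base_scalar gs x.
have [|||J [[P [FP Pcoef JE]] Jmin]] :=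
  IH (fun J => exists P, [/\ F P, forall a, coef P a -> I a & J = below P]).
- move=> _ [P [/subF[P0' PD] _ ->]]; split.
    by split=> //; exact: span0 base_scalar_set.
  move=> a x y [Px xP] [Py yP]; split; first exact: PD.
  exact: spanP base_scalar_set (base_scalarE a) xP yP.
- by move=> _ [P [_ _ ->]] x [].
- by exists (below P1), P1; split=> //; rewrite IE.
exists P; split=> // Q FQ QP x Px.
have QI a : coef Q a -> I a.
  by move=> [y [Qy yP]]; apply: Pcoef; exists y; split=> //; exact: QP.
have IQ := Imin _ (ex_intro _ Q (conj FQ erefl)) QI.
have PQ y : below P y -> below Q y.
  rewrite -JE; apply: Jmin; first by exists Q.
  by rewrite JE => z [Qz zP]; split=> //; exact: QP.
have [c [[a ca] xa]] := spanF _ FP x Px.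
have [|y [Qy ya]] := IQ a; first by apply: Pcoef; exists x; split; rewrite -?ca.
have [|Qxy _] := PQ (x - y).
  split; first exact: (base_submoduleB (subF _ FP) Px (QP _ Qy)).
  (* x and y have the same coefficient along g *)
  rewrite (_ : x - y = central_scale (-1) (y - central_scale a g) + (x - c g)).
    exact: spanP base_scalar_set (base_scalarE _) ya xa.
  rewrite ca [central_scale (-1) _]/= rmorphN1 scaleN1r opprB.
  by rewrite [RHS]addrC addrA subrK.
have := base_submoduleB (subF _ FQ) Qxy
  (base_submoduleB (subF _ FQ) (subF _ FQ).1 Qy).
by rewrite sub0r opprK subrK.
Qed.

Section SurjectiveEndo.
Context (f : {linear M -> M}).
Hypothesis f_surj : surj f.

(** The bicommutant of f: a commutative ring of endomorphisms that contains f
    and the base ring. *)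
Let C (c : {linear M -> M}) : Prop := forall t : {linear M -> M},
  (forall x, t (f x) = f (t x)) -> forall x, t (c x) = c (t x).

Let Cf c : C c -> forall x, f (c x) = c (f x).
Proof. by move=> Cc; exact: Cc. Qed.

Let CC c d : C c -> C d -> forall x, c (d x) = d (c x).
Proof. by move=> Cc Cd; apply: Cd => x; rewrite Cf. Qed.

Let C_set : scalar_set C.
Proof.
split=> [t _ x|r s t Cr Cs Ct u uf x] /=; first by rewrite linear0.
by rewrite linearD (Cr u uf) (Cs u uf) (Ct u uf).
Qed.

Let base_C c : base_scalar c -> C c.
Proof. by move=> [a ca] t _ x; rewrite !ca /= linearZ. Qed.

(** Nakayama's argument for M = f M, with operators from the bicommutant: the
    operators e = 1 + b f sending M into the span of gs are multiplied until
    gs is empty, and then e = 0 makes - b a left inverse of f. *)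
Let surj_inj_rec gs (e b : {linear M -> M}) :
    C e -> C b -> (forall x, e x = x + b (f x)) ->
    (forall x, span C gs (e x)) ->
  injective f.
Proof.
elim: gs e b => [|g gs IH] e b Ce Cb eE eS.
  apply: kernel0_inj => x fx.
  by have := eS x; rewrite /= eE fx linear0 addr0.
(* modulo the span of gs, e g = f (e y) is f (c g), so e - f c kills g *)
have [y fy] := f_surj g; have [c [Cc yS]] := eS y.
pose e' : {linear M -> M} := (e \o e) \- (f \o (c \o e)).
pose b' : {linear M -> M} := (b \+ (b \o e)) \- (c \o e).
apply: (IH e' b').
- by move=> t tf x; rewrite /= linearB tf (Cc t tf) !(Ce t tf).
- move=> t tf x; rewrite /= linearB linearD (Cc t tf) !(Cb t tf).
  by rewrite (Ce t tf).
- move=> x; rewrite /= [e (e x)]eE (Cf Ce) {1}eE (Cf Cc) (Cf Ce).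
  by rewrite !addrA.
move=> x; have [d [Cd xS]] := eS x.
have ->: e' x =
    e (e x - d g) + ((\- (f \o c)) (e x - d g) + (d \o f) (e y - c g)).
  rewrite /= -{1 2}[e x](subrK (d g)); set z := e x - d g.
  rewrite !linearD !linearN /= addrACA -addrA; congr (_ + (_ + _)).
  by rewrite -fy !(Cf Cd, Cf Ce, Cf Cc) !(CC Ce Cd, CC Cc Cd).
have Cid : C idfun by [].
have CM r s : C r -> C s -> C (r \o s).
  by move=> Cr Cs t tf z; rewrite /= (Cr t tf) (Cs t tf).
apply: (spanP C_set Ce) => //; apply: (spanP C_set) => //.
  by move=> t tf z; rewrite /= linearN tf (Cc t tf).
rewrite -[(d \o f) _]addr0; apply: (@spanP _ _ C gs (d \o f)) => //.
- by apply: CM => //; exact: (fun t tf => tf).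
- exact: span0.
Qed.

Lemma surj_endo_inj gs : (forall x, span base_scalar gs x) -> injective f.
Proof.
move=> gsP; apply: (@surj_inj_rec gs idfun \0) => //.
- by move=> t _ x /=; rewrite linear0.
- by move=> x; rewrite /= addr0.
- by move=> x; exact: span_subset base_C (gsP x).
Qed.

End SurjectiveEndo.
End Module.
End ArtinAlgebra.

Section ArtinAlgebraModules.
Context (L : pzRingType).
Hypothesis artinL : artin_algebra L.
Implicit Types M N A B : rmodType L.

Lemma fin_gen_artinian M : fin_gen M -> artinian_module M.
Proof.
have [k [phi [artk phiC fgL]]] := artinL.
move=> /(fin_gen_base phiC fgL)[gs gsP] F subF exF.
apply: (@base_minimal L k phi phiC M gs) => //.
by move=> P /subF [P0 PD]; split=> // a x y; exact: PD.
Qed.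

Lemma surjective_endo_injective M (f : {linear M -> M}) :
  fin_gen M -> surj f -> injective f.
Proof.
have [k [phi [_ phiC fgL]]] := artinL.
move=> /(fin_gen_base phiC fgL)[gs gsP] sf.
exact: (surj_endo_inj sf gsP).
Qed.

(** * Indecomposable modules *)

Lemma indecomposable_sum M A B (i : {linear A -> M}) (j : {linear B -> M}) :
    indecomposable M -> injective i -> injective j ->
    (forall a b, i a = j b -> a = 0) ->
    (forall x, exists a b, x = i a + j b) ->
  (forall a : A, a = 0) \/ (forall b : B, b = 0).
Proof.
move=> [_ indM] inj_i inj_j disj spn.
exact/indM/(direct_sum_iso inj_i inj_j).
Qed.

(** Fitting's lemma.  When the images of the powers of f become stationary at
    F = f^(n+1), the map F is onto when restricted to its image A, hence
    injective there, so that the module is the direct sum of A and ker F. *)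
Theorem endo_bijective_or_nilpotent M (f : {linear M -> M}) :
    fin_gen M -> indecomposable M ->
  bijective f \/ exists n, forall x, iter n f x = 0.
Proof.
move=> fgM indM.
(* positive powers only, so that f is injective as soon as F is *)
pose img n (y : M) := exists x, iter n.+1 f x = y.
have [||_ [[n ->] nmin]] :=
  fin_gen_artinian fgM (F := fun P => exists n, P = img n).
- move=> _ [n ->]; have [g gP] := iter_linear f n.+1.
  rewrite /img; under boolp.eq_fun do under eq_exists do rewrite -gP.
  exact: image_submodule.
- by exists (img 0%N), 0%N.
have imgS m y : img (n + m)%N y -> img n y.
  by move=> [x <-]; exists (iter m f x); rewrite -iterD addSn.
have img_stable m y : img n y -> img (n + m)%N y.
  by apply: nmin; [exists (n + m)%N | exact: imgS].
have [F FE] := iter_linear f n.+1.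
have [A [i [F' [inj_i surjF' iF']]]] := mono_image F.
have [K [j [inj_j jP]]] := submodule_exists (kernel_submodule F).
have FF x : exists z, F (F z) = F x.
  have [|z zP] := img_stable n.+1 (F x); first by exists x; rewrite -FE.
  by exists z; rewrite -zP 2!FE -iterD.
have Fi_surj : surj (F' \o i).
  move=> a; have [x <-] := surjF' a; have [z zP] := FF x.
  by exists (F' z); apply: inj_i; rewrite /= !iF' zP.
have Fi_inj : injective (F' \o i : {linear A -> A}).
  by apply: surjective_endo_injective => //; exact: fin_gen_surj surjF'.
have [|x|A0|K0] := indecomposable_sum indM inj_i inj_j.
- move=> a b e; apply: Fi_inj; rewrite linear0 /= e; apply: inj_i.
  by rewrite iF' linear0; apply/jP; exists b.
- have [z zP] := FF x; have /jP[b bP] : F (x - F z) = 0.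
    by rewrite linearB zP subrr.
  by exists (F' z), b; rewrite bP iF' addrC subrK.
- by right; exists n.+1 => x; rewrite -FE -iF' (A0 (F' x)) linear0.
- left; have F_inj : injective F.
    apply: kernel0_inj => x /jP[b <-].
    by rewrite (K0 b) linear0.
  apply: inj_surj_bij => [x y e|x].
    by apply: F_inj; rewrite !FE !iterSr e.
  have [z /F_inj <-] := FF x; exists (iter n f z); exact: esym (FE z).
Qed.

Lemma injective_endo_bijective M (f : {linear M -> M}) :
  fin_gen M -> indecomposable M -> injective f -> bijective f.
Proof.
move=> fgM indM inj_f.
have [//|[n n0]] := endo_bijective_or_nilpotent f fgM indM.
have [[x x0] _] := indM; case: x0; elim: n n0 => [|n IH] n0; first exact: n0.
by apply: IH => y; apply: inj_f; rewrite linear0 -iterS n0.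
Qed.

(** The endomorphism ring of an indecomposable module is local. *)
Lemma sum_bijective_local M (f g : {linear M -> M}) :
    fin_gen M -> indecomposable M -> bijective (f \+ g) ->
  bijective f \/ bijective g.
Proof.
move=> fgM indM bfg.
have [h [hK Kh]] := linear_inverse (f := f \+ g : {linear M -> M}) bfg.
have bh : bijective h by exists (f \+ g).
have hE x : h (f x) + h (g x) = x by rewrite -linearD -[RHS]hK.
have [bhf|[n n0]] :=
  endo_bijective_or_nilpotent (h \o f : {linear M -> M}) fgM indM.
  by left; apply: (eq_bij (bij_comp bfg bhf)) => x; exact: Kh.
right; have bhg : bijective (h \o g).
  apply: (injective_endo_bijective (f := h \o g : {linear M -> M})) => //.
  apply: kernel0_inj => x /= gx.
  have fx : (h \o f) x = x by rewrite -[RHS]hE gx addr0.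
  rewrite -(n0 x); elim: (n) => //= m <-; exact: esym fx.
by apply: (eq_bij (bij_comp bfg bhg)) => x; exact: Kh.
Qed.

End ArtinAlgebraModules.

(** * Finite families of modules and summands *)

Section FiniteUpToIso.
Context (L : pzRingType).
Implicit Types (M N : rmodType L) (C : rmodType L -> Prop).

Definition finite_up_to_iso C : Prop :=
  exists (n : nat) (N : 'I_n -> rmodType L),
    forall M, C M -> exists i, isomorphic M (N i).

Lemma finite_up_to_iso_sub C C' :
  (forall M, C M -> C' M) -> finite_up_to_iso C' -> finite_up_to_iso C.
Proof. by move=> CC' [n [N NP]]; exists n, N => M /CC'; exact: NP. Qed.

Lemma finite_up_to_iso0 : finite_up_to_iso (fun=> False).
Proof. by exists 0%N, (fun=> 'rV[L^c]_0 : rmodType L). Qed.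

Lemma finite_up_to_iso1 N : finite_up_to_iso (fun M => isomorphic M N).
Proof. by exists 1%N, (fun=> N) => M MN; exists ord0. Qed.

Lemma finite_up_to_isoU C C' : finite_up_to_iso C -> finite_up_to_iso C' ->
  finite_up_to_iso (fun M => C M \/ C' M).
Proof.
move=> [n [N NP]] [n' [N' NP']].
exists (n + n')%N.
exists (fun i => match split i with inl j => N j | inr j => N' j end).
move=> M [/NP[i iP]|/NP'[i iP]].
  by exists (lshift n' i); rewrite (unsplitK (inl i)).
by exists (rshift n i); rewrite (unsplitK (inr i)).
Qed.

Lemma finite_up_to_iso_bigcup n (C : 'I_n -> rmodType L -> Prop) :
  (forall i, finite_up_to_iso (C i)) ->
  finite_up_to_iso (fun M => exists i, C i M).
Proof.
elim: n C => [|n IH] C CP.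
  by apply: finite_up_to_iso_sub finite_up_to_iso0 => M [[]].
have := finite_up_to_isoU (CP ord0) (IH _ (fun i => CP (lift ord0 i))).
apply: finite_up_to_iso_sub => M [i]; case: (unliftP ord0 i) => [j|] -> Ci.
  by right; exists j.
by left.
Qed.

End FiniteUpToIso.

Section Summands.
Context (L : pzRingType).
Hypothesis artinL : artin_algebra L.
Implicit Types M N A B X G : rmodType L.

Definition summand_of G X : Prop :=
  exists (a : {linear G -> X}) (b : {linear X -> G}), bijective (b \o a).

Lemma summand_of_indecomposable G X :
  indecomposable G -> indecomposable X -> summand_of G X -> isomorphic G X.
Proof.
move=> [[g g0] _] indX [a [b bba]].
have [h [hK Kh]] := linear_inverse (f := b \o a : {linear G -> G}) bba.
have [K [j [inj_j jP]]] := submodule_exists (kernel_submodule b).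
have inj_a : injective a by exact: inj_compr (bij_inj bba).
have [|x|G0|K0] := indecomposable_sum indX inj_a inj_j.
- move=> x y e; apply: (bij_inj bba); rewrite linear0 /= e.
  by apply/jP; exists y.
- have /jP[y yP] : b (x - a (h (b x))) = 0.
    by rewrite linearB; apply/eqP; rewrite subr_eq0 -[eqbLHS]Kh.
  by exists (h (b x)), y; rewrite yP addrC subrK.
- by case: g0.
- apply: isomorphic_sym; exists b; apply: inj_surj_bij => [|x].
    by apply: kernel0_inj => x /jP[y <-]; rewrite (K0 y) linear0.
  by exists (a (h x)); exact: Kh.
Qed.

Lemma pair0r_linear A B : linear (fun x : A => (x, 0) : A * B).
Proof. by move=> a x y; congr (_, _); rewrite /= ?scaler0 ?addr0. Qed.

Lemma pair0l_linear A B : linear (fun y : B => (0, y) : A * B).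
Proof. by move=> a x y; congr (_, _); rewrite /= ?scaler0 ?addr0. Qed.

Lemma isomorphic_prod_maps X A B : isomorphic X (A * B)%type ->
  exists (i : {linear A -> X}) (j : {linear B -> X})
    (p : {linear X -> A}) (q : {linear X -> B}),
    [/\ cancel i p, cancel j q, forall y, p (j y) = 0 &
        forall x, i (p x) + j (q x) = x].
Proof.
move=> [f /linear_inverse[g [fK gK]]].
exists (g \o to_linear (@pair0r_linear A B) : {linear A -> X}).
exists (g \o to_linear (@pair0l_linear A B) : {linear B -> X}).
exists (fst \o f : {linear X -> A}), (snd \o f : {linear X -> B}).
split=> [x|x|x|x] /=; rewrite ?gK // -linearD -[RHS]fK; congr (g _).
by rewrite [RHS]surjective_pairing; congr (_, _); rewrite /= ?addr0 ?add0r.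
Qed.

Lemma summand_of_prod G X A B : fin_gen G -> indecomposable G ->
  isomorphic X (A * B)%type -> summand_of G X ->
  summand_of G A \/ summand_of G B.
Proof.
move=> fgG indG /isomorphic_prod_maps[i [j [p [q [_ _ _ ijE]]]]] [a [b bba]].
have [] := sum_bijective_local artinL (f := (b \o i) \o (p \o a))
  (g := (b \o j) \o (q \o a)) fgG indG.
- by apply: (eq_bij bba) => x; rewrite /= -linearD ijE.
- by left; exists (p \o a : {linear G -> A}), (b \o i : {linear A -> G}).
- by right; exists (q \o a : {linear G -> B}), (b \o j : {linear B -> G}).
Qed.

(** Among the submodules A of X with infinitely many indecomposable summands, a
    minimal one is neither zero, nor indecomposable, nor a proper direct sum:
    by locality, a summand of a direct sum is a summand of one of the two terms. *)
Theorem finitely_many_summands X : fin_gen X ->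
  finite_up_to_iso
    (fun G => [/\ fin_gen G, indecomposable G & summand_of G X]).
Proof.
move=> fgX; pose S A G := [/\ fin_gen G, indecomposable G & summand_of G A].
apply: contrapT => notX.
have [||P0 [[A [i [[inj_i iP] notA]]] Amin]] := fin_gen_artinian artinL fgX
  (F := fun P => exists (A : rmodType L) (i : {linear A -> X}),
     mono_onto P i /\ ~ finite_up_to_iso (S A)).
- move=> P [A [i [[_ iP] _]]]; rewrite (_ : P = fun x => exists a, i a = x).
    exact: image_submodule.
  by apply/funext => x; apply/propext.
- exists xpredT, X, (idfun : {linear X -> X}); split=> //; split=> // x.
  by split=> // _; exists x.
(* by minimality, A has no proper submodule with infinitely many summands *)
have Amax B (h : {linear B -> A}) : injective h ->
    ~ finite_up_to_iso (S B) -> surj h.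
  move=> inj_h notB x.
  have [|||b bP] := Amin (fun x => exists b, i (h b) = x) _ _ (i x).
  - exists B, (i \o h : {linear B -> X}); split=> //; split=> //.
    exact: inj_comp.
  - by move=> _ [b <-]; apply/iP; exists (h b).
  - by apply/iP; exists x.
  by exists b; apply: inj_i.
have [indA|decA] := pselect (indecomposable A).
  apply: notA; apply: finite_up_to_iso_sub (finite_up_to_iso1 A) => G.
  by move=> [_ indG]; exact: summand_of_indecomposable.
have [A0|/existsNP[x0 x0P]] := pselect (forall x : A, x = 0).
  apply: notA; apply: finite_up_to_iso_sub (finite_up_to_iso0 L) => G.
  move=> [_ [[g g0] _] [a [b bba]]]; apply: g0; apply: (bij_inj bba).
  by rewrite /= [a g]A0 [a 0]A0.
have /existsNP[B /existsNP[C /not_implyP[AE /not_orP[Bn0 Cn0]]]] :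
    ~ forall B C : rmodType L, isomorphic A (B * C)%type ->
      (forall b : B, b = 0) \/ (forall c : C, c = 0).
  by move=> indA; apply: decA; split=> //; exists x0.
have [j [l [p [q [jK lK pl0 jlE]]]]] := isomorphic_prod_maps AE.
apply: notA.
apply: finite_up_to_iso_sub (fun G => S B G \/ S C G) _ _.
  by move=> G [fgG indG] /(summand_of_prod fgG indG AE)[]; [left | right].
apply: finite_up_to_isoU; apply: contrapT => notF.
- apply: Cn0 => c; have [b bP] := Amax _ _ (can_inj jK) notF (l c).
  have b0 : b = 0 by rewrite -[b]jK bP pl0.
  by rewrite -[c]lK -bP b0 !linear0.
- apply: Bn0 => b; have [c cP] := Amax _ _ (can_inj lK) notF (j b).
  by rewrite -[b]jK -cP pl0.
Qed.

End Summands.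

(** * Simple modules *)

Section Simple.
Context (L : pzRingType).
Implicit Types M N S T : rmodType L.

Definition regular : rmodType L := (L^c)^o.

Definition simple S : Prop :=
  (exists x : S, x <> 0) /\
  forall P : S -> Prop, submodule P -> (exists x, P x /\ x <> 0) ->
    forall x, P x.

Lemma regular_fin_gen : fin_gen regular.
Proof.
exists 1%N, (fun=> (1 : L^c)) => x; exists (fun=> x).
by rewrite big_ord1 [RHS]mulr1.
Qed.

Lemma orbit_linear M (x : M) : linear (fun a : regular => (a : L^c) *: x).
Proof. by move=> a b c; rewrite scalerDl [a *: b]/(a * b) -scalerA. Qed.

Lemma simple_surj M S (f : {linear M -> S}) :
  simple S -> (exists x, f x <> 0) -> surj f.
Proof.
move=> [_ simS] [x fx]; apply: simS; first exact: image_submodule.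
by exists (f x); split=> //; exists x.
Qed.

Lemma simple_inj S M (f : {linear S -> M}) :
  simple S -> (exists x, f x <> 0) -> injective f.
Proof.
move=> [_ simS] [x fx]; apply: kernel0_inj => y fy; apply: contrapT => y0.
by apply: fx; apply: simS (kernel_submodule f) _ x; exists y.
Qed.

Lemma simple_regular_quotient S : simple S ->
  exists q : {linear regular -> S}, surj q.
Proof.
move=> simS; have [[x x0] _] := simS; exists (to_linear (orbit_linear x)).
by apply: simple_surj => //; exists (1 : L^c); rewrite /= scale1r.
Qed.

(** Zorn's lemma, applied to the submodules that miss some generator.  Zero is
    left out of the closure condition so that the empty set, the union of the
    empty chain, qualifies. *)
Lemma simple_quotient M : fin_gen M -> (exists x : M, x <> 0) ->
  exists (S : rmodType L) (p : {linear M -> S}), simple S /\ surj p.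
Proof.
move=> [n [g gP]] [x0 x0P].
have gen0 : exists i, g i <> 0.
  apply: contrapT => /forallNP g0; apply: x0P; have [c ->] := gP x0.
  by apply: big1 => i _; rewrite (contrapT (g0 i)) scaler0.
have [i0 gi0] := gen0.
pose closed (P : set M) := forall a x y, P x -> P y -> P (a *: x + y).
have gen_closed (P : M -> Prop) :
    submodule P -> (forall i, P (g i)) -> forall x, P x.
  move=> [P0 PD] Pg x; have [c ->] := gP x.
  elim/big_rec: _ => // i y _ Py; exact: PD.
have closed0 P x : closed P -> P x -> P 0.
  by move=> cP Px; rewrite -(addNr x) -scaleN1r; exact: cP.
have [F FP Ftot|A [[cA gA] Amax]] :=
  @Zorn_bigcup M (fun P => closed P /\ ~ forall i, P (g i)).
  split=> [a x y [P FPP Px] [Q FQ Qy]|allg].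
    have [PQ|QP] := Ftot _ _ FPP FQ.
    - by exists Q => //; apply: (FP _ FQ).1 => //; exact: PQ.
    - by exists P => //; apply: (FP _ FPP).1 => //; exact: QP.
  have [P FPP Pg] : exists2 P, F P & forall i, i \in enum 'I_n -> P (g i).
    elim: (enum 'I_n) => [|i s [P FPP Ps]].
      by have [P FPP _] := allg i0; exists P.
    have [Q FQ Qi] := allg i; have [PQ|QP] := Ftot _ _ FPP FQ.
    - by exists Q => // j; rewrite inE => /predU1P[->|/Ps /PQ].
    - by exists P => // j; rewrite inE => /predU1P[->|/Ps]; first exact: QP.
  by apply: (FP _ FPP).2 => i; apply: Pg; rewrite mem_enum.
have sA : submodule A.
  split=> //; apply: contrapT => A0.
  have nA x : ~ A x by move=> /(closed0 _ _ cA).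
  apply: (Amax (eq^~ 0)); first by split=> [x /nA//|/(_ 0 erefl)].
  split=> [a x y -> ->|/(_ i0)]; first by rewrite scaler0 addr0.
  exact: gi0.
have [S [p [sp pA]]] := quotient_exists sA.
exists S, p; split=> //; split.
  apply: contrapT => /forallNP S0; apply: gA => i; apply/pA.
  exact: (contrapT (S0 _)).
move=> P sP [s [Ps s0]] t.
have [x px] := sp t; rewrite -px.
have sPp : submodule (P \o p).
  split=> [|a y z Py Pz]; first by rewrite /= linear0; exact: sP.1.
  by rewrite /= linearP; exact: sP.2.
apply: (gen_closed (P \o p) sPp _ x); apply: contrapT => nPg.
apply: (Amax (P \o p)); last by split=> //; exact: sPp.2.
split=> [y /pA py|PA]; first by rewrite /= py; exact: sP.1.
have [y py] := sp s; apply: s0; rewrite -py; apply/pA/PA.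
by rewrite /= py.
Qed.

(** Such a map, when nonzero, stands for a maximal right ideal: its kernel. *)
Record simple_map := SimpleMap {
  smap_mod : rmodType L;
  smap :> {linear regular -> smap_mod};
  smap_simple : simple smap_mod
}.

Fixpoint common_kernel (ts : seq simple_map) (x : regular) : Prop :=
  if ts is t :: ts' then t x = 0 /\ common_kernel ts' x else True.

Lemma common_kernel_submodule ts : submodule (common_kernel ts).
Proof.
elim: ts => [|t ts [IH0 IHD]] /=; first by split.
split=> [|a x y [tx xP] [ty yP]]; first by rewrite linear0.
by rewrite linearP tx ty scaler0 addr0; split=> //; exact: IHD.
Qed.

(** Let S = L/m be simple, where m contains the common kernel of t :: ts but not
    the common kernel I of ts.  Then t and L -> S both map I onto their simple
    targets, and the first kernel in I lies in the second, so that the target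
    of t maps onto S and is isomorphic to it. *)
Lemma finite_simple_above ts :
  finite_up_to_iso (fun S => simple S /\ exists q : {linear regular -> S},
    surj q /\ forall x, common_kernel ts x -> q x = 0).
Proof.
elim: ts => [|t ts /finite_up_to_isoU IH].
  apply: finite_up_to_iso_sub (finite_up_to_iso0 L).
  move=> S [[[y y0] _] [q [sq q0]]]; apply: y0.
  by have [x <-] := sq y; exact: q0.
apply: finite_up_to_iso_sub (IH _ (finite_up_to_iso1 (smap_mod t))).
move=> S [simS [q [sq qK]]].
have [qts|/existsNP[x /not_implyP[xts qx]]] :=
  pselect (forall x, common_kernel ts x -> q x = 0).
  by left; split=> //; exists q.
right; have [A [i [_ iP]]] := submodule_exists (common_kernel_submodule ts).
have tq a : (t \o i) a = 0 -> (q \o i) a = 0.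
  by move=> ta; apply: qK; split=> //; apply/iP; exists a.
have /iP[a ax] := xts.
have qa : (q \o i) a <> 0 by rewrite /= ax.
have [|r rP] :=
    factor_epi (p := t \o i : {linear A -> smap_mod t}) (q := q \o i) _ tq.
  by apply: simple_surj; [exact: smap_simple | exists a => /tq].
apply: isomorphic_sym; exists r; apply: inj_surj_bij.
  by apply: simple_inj; [exact: smap_simple | exists ((t \o i) a); rewrite rP].
by apply: simple_surj => //; exists ((t \o i) a); rewrite rP.
Qed.

(** A minimal finite intersection of maximal right ideals lies in every maximal
    right ideal, so [finite_simple_above] covers all simple modules. *)
Theorem finitely_many_simples :
  artin_algebra L -> finite_up_to_iso simple.
Proof.
move=> artinL.
have [||P0 [[ts ->] tsmin]] := fin_gen_artinian artinL regular_fin_gen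
  (F := fun P => exists ts, P = common_kernel ts).
- by move=> _ [ts ->]; exact: common_kernel_submodule.
- by exists (common_kernel [::]), [::].
apply: finite_up_to_iso_sub (finite_simple_above ts) => S simS.
split=> //; have [q sq] := simple_regular_quotient simS.
exists q; split=> // x xts.
have [||qx _ //] := tsmin (common_kernel (SimpleMap q simS :: ts)) _ _ x xts.
- by exists (SimpleMap q simS :: ts).
- by move=> y [].
Qed.

End Simple.

(** * Maps factoring through projectives *)

Section Projective.
Context (L : pzRingType).
Hypothesis artinL : artin_algebra L.
Implicit Types M N K S P G A B : rmodType L.

Lemma regular_projective : projective (regular L).
Proof.
move=> N N' g h sg; have [y yP] := sg (h (1 : L^c)).
exists (to_linear (orbit_linear y)) => x /=.
by rewrite linearZ yP -linearZ; congr (h _); exact: mulr1.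
Qed.

Lemma factors_projP M N (f : {linear M -> N}) :
  factors_proj (f : mhom M N) <->
  exists P (g : {linear M -> P}) (h : {linear P -> N}),
    fg_projective P /\ forall x, f x = h (g x).
Proof.
split=> [[P [g [h [pP fE]]]]|[P [g [h [pP fE]]]]]; exists P, g, h; split=> //.
  by move=> x; exact: (congr1 (fun u : mhom M N => mhom_fun u x) fE).
exact: mhomP.
Qed.

Lemma factors_proj_comp M N K (f : {linear M -> N}) (g : {linear N -> K}) :
  factors_proj (f : mhom M N) -> factors_proj (g \o f : mhom M K).
Proof.
move=> /factors_projP[P [a [b [pP fE]]]]; apply/factors_projP.
by exists P, a, (g \o b : {linear P -> K}); split=> // x; rewrite /= fE.
Qed.

Lemma factors_proj_id M :
  factors_proj (idfun : mhom M M) -> fg_projective M.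
Proof.
move=> /factors_projP[P [a [b [[fgP pP] baE]]]]; split.
  by apply: (fin_gen_surj (f := b) fgP) => x; exists (a x); rewrite -baE.
move=> N N' g h sg; have [l lP] := pP _ _ g (h \o b : {linear P -> N'}) sg.
by exists (l \o a : {linear M -> N}) => x; rewrite /= lP /= -baE.
Qed.

(** A nilpotent e would give p = p e^n = 0. *)
Lemma bijective_over_nonzero M N (p : {linear M -> N}) (e : {linear M -> M}) :
    fin_gen M -> indecomposable M -> (exists x, p x <> 0) ->
    (forall x, p (e x) = p x) ->
  bijective e.
Proof.
move=> fgM indM [x px] pe.
have [//|[n n0]] := endo_bijective_or_nilpotent artinL e fgM indM.
by case: px; rewrite -(linear0 p) -(n0 x); elim: n {n0} => //= n ->.
Qed.

(** The endomorphism b a of G commutes with the maps onto a common simple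
    quotient of G and of the regular module. *)
Lemma projective_summand_regular G :
  fg_projective G -> indecomposable G -> summand_of G (regular L).
Proof.
move=> [fgG pG] indG.
have [S [p [simS sp]]] := simple_quotient fgG indG.1.
have [q sq] := simple_regular_quotient simS.
have [a aP] := pG _ _ q p sq; have [b bP] := regular_projective q sp.
exists a, b; apply: (bijective_over_nonzero (p := p) (e := b \o a)) => //.
  have [[s s0] _] := simS; have [x px] := sp s.
  by exists x; rewrite px.
by move=> x; rewrite /= bP aP.
Qed.

(** For a minimal submodule A of G that receives a stably nonzero map f, every
    map from G to a proper submodule of A is stably zero.  If the composite of f
    with A -> S were stably zero, correcting f by a map through a projective
    would give a map into the kernel of A -> S, a proper submodule. *)
Lemma nonprojective_map_to_simple G : fin_gen G -> ~ fg_projective G ->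
  exists S (f : {linear G -> S}), simple S /\ ~ factors_proj (f : mhom G S).
Proof.
move=> fgG npG.
have [||P0 [[A [i [f [[inj_i iP] nf]]]] Amin]] := fin_gen_artinian artinL fgG
  (F := fun U => exists (A : rmodType L) (i : {linear A -> G})
     (f : {linear G -> A}), mono_onto U i /\ ~ factors_proj (f : mhom G A)).
- move=> U [A [i [_ [[_ iP] _]]]]; rewrite (_ : U = fun x => exists a, i a = x).
    exact: image_submodule.
  by apply/funext => x; apply/propext.
- exists xpredT, G, idfun, idfun; split; last by move=> /factors_proj_id.
  by split=> // x; split=> // _; exists x.
have Amax B (j : {linear B -> A}) (h : {linear G -> B}) :
    injective j -> ~ factors_proj (h : mhom G B) -> surj j.
  move=> inj_j nh x.
  have [|||b bP] := Amin (fun x => exists b, i (j b) = x) _ _ (i x).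
  - exists B, (i \o j : {linear B -> G}), h; split=> //; split=> //.
    exact: inj_comp.
  - by move=> _ [b <-]; apply/iP; exists (j b).
  - by apply/iP; exists x.
  by exists b; apply: inj_i.
have sf : surj f.
  have [B [j [h [inj_j sh jh]]]] := mono_image f.
  move=> x; have [|b <-] := Amax _ _ h inj_j _ x.
    move=> /(factors_proj_comp j) jhP; apply: nf.
    rewrite (_ : f = j \o h :> mhom G A) //.
    by apply: mhomP => y; exact: esym (jh y).
  by have [y <-] := sh b; exists y; rewrite jh.
have fgA : fin_gen A by exact: fin_gen_surj sf.
have [|S [p [simS sp]]] := simple_quotient fgA.
  apply: contrapT => /forallNP A0; apply: nf; apply/factors_projP.
  exists ('rV[L^c]_0 : rmodType L), \0, \0; split; first exact: fg_projective0.
  by move=> x; exact: (contrapT (A0 _)).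
exists S, (p \o f : {linear G -> S}); split=> // /factors_projP.
move=> [P [a [b [fpP pfE]]]]; have [_ pP] := fpP.
have [b' bP] := pP _ _ p b sp.
have [K [j [inj_j jP]]] := submodule_exists (kernel_submodule p).
have [|h hP] := lift_mono (h := f \- (b' \o a) : {linear G -> A}) inj_j.
  by move=> x; apply/jP; rewrite /= linearB bP -pfE subrr.
have hF : factors_proj (h : mhom G K).
  apply: contrapT => /(Amax _ _ _ inj_j) sj.
  have [[s s0] _] := simS; apply: s0; have [x <-] := sp s.
  by apply/jP; exact: sj.
apply: nf; have /proj_mapsP jhF := factors_proj_comp j hF.
have baF : (b' \o a : mhom G A) \in proj_maps G A.
  by apply/proj_mapsP; exists P, a, b'; split=> //; exact: mhomP.
apply/proj_mapsP.
rewrite (_ : (f : mhom G A) = (j \o h : mhom G A) + (b' \o a : mhom G A)).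
  exact: rpredD.
apply: mhomP => x; rewrite /mhom_fun /= -[RHS]/(j (h x) + b' (a x)).
by rewrite hP /= subrK.
Qed.

End Projective.

(** * Semisimplicity of the category of finitely presented functors *)

Lemma cmpBl (X : preadditive) (x y z : X) (g g' : Mor y z) (f : Mor x y) :
  cmp (g - g') f = cmp g f - cmp g' f.
Proof. exact: (raddfB (precomp f)). Qed.

Section RepresentableCokernel.
Context (X : preadditive) (x y : X) (u : Mor x y).

Definition postcomp z (c : Mor z x) : Mor z y := cmp u c.

Lemma postcomp_is_zmod_morphism z : zmod_morphism (@postcomp z).
Proof.
by move=> a b; apply/eqP; rewrite /postcomp eq_sym subr_eq -cmpDr subrK.
Qed.

HB.instance Definition _ z := GRing.isZmodMorphism.Build (Mor z x) (Mor z y)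
  (@postcomp z) (@postcomp_is_zmod_morphism z).

Definition postcomp_nat : nattrans (representable x) (representable y) :=
  @MkNattrans X (representable x) (representable y)
    (fun z => @postcomp z : {additive Mor z x -> Mor z y})
    (fun z z' f c => cmpA u c f).

Definition postcomp_image z : {pred Mor z y} :=
  fun b => `[< exists c, postcomp c = b >].

Lemma postcomp_image_closed z : zmod_closed (@postcomp_image z).
Proof.
split; first by apply/asboolP; exists 0; rewrite raddf0.
by move=> _ _ /asboolP[a <-] /asboolP[b <-]; apply/asboolP; exists (a - b);
  rewrite raddfB.
Qed.

HB.instance Definition _ z := GRing.isZmodClosed.Build (Mor z y)
  (@postcomp_image z) (@postcomp_image_closed z).

Definition coker z : zmodType := {ideal_quot (@postcomp_image z)}.
Definition coker_proj z (b : Mor z y) : coker z :=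
  \pi_{ideal_quot (@postcomp_image z)} b.
Definition coker_repr z (q : coker z) : Mor z y :=
  repr (q : {ideal_quot (@postcomp_image z)}).

Lemma coker_reprK z (q : coker z) : coker_proj (coker_repr q) = q.
Proof. exact: reprK. Qed.

Lemma coker_projP z (a b : Mor z y) :
  coker_proj a = coker_proj b <-> exists c, postcomp c = a - b.
Proof.
split=> [/eqP|]; first by rewrite -Quotient.idealrBE => /asboolP.
by move=> /asboolP ab; apply/eqP; rewrite -Quotient.idealrBE.
Qed.

Lemma coker_proj_is_zmod_morphism z : zmod_morphism (@coker_proj z).
Proof. by move=> a b; rewrite /coker_proj piE. Qed.

HB.instance Definition _ z := GRing.isZmodMorphism.Build (Mor z y) (coker z)
  (@coker_proj z) (@coker_proj_is_zmod_morphism z).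

Definition coker_map z z' (f : Mor z z') (q : coker z') : coker z :=
  coker_proj (cmp (coker_repr q) f).

Lemma coker_map_proj z z' (f : Mor z z') b :
  coker_map f (coker_proj b) = coker_proj (cmp b f).
Proof.
have [c cP] : exists c, postcomp c = coker_repr (coker_proj b) - b.
  by apply/coker_projP; rewrite coker_reprK.
apply/coker_projP; exists (cmp c f); rewrite /postcomp cmpA.
by rewrite -[cmp u c]/(postcomp c) cP cmpBl.
Qed.

Lemma coker_map_is_zmod_morphism z z' (f : Mor z z') :
  zmod_morphism (coker_map f).
Proof.
move=> q q'; rewrite -[q]coker_reprK -[q']coker_reprK.
rewrite -(raddfB (@coker_proj z')).
by rewrite !coker_map_proj -(raddfB (@coker_proj z)) cmpBl.
Qed.

HB.instance Definition _ z z' (f : Mor z z') := GRing.isZmodMorphism.Build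
  (coker z') (coker z) (coker_map f) (coker_map_is_zmod_morphism f).

Lemma coker_map1 z (q : coker z) : coker_map (idm z) q = q.
Proof. by rewrite -[q]coker_reprK coker_map_proj cmpm1. Qed.

Lemma coker_map_cmp z z' w (g : Mor z' w) (f : Mor z z') q :
  coker_map (cmp g f) q = coker_map f (coker_map g q).
Proof. by rewrite -[q]coker_reprK !coker_map_proj cmpA. Qed.

Lemma coker_mapD z z' (f g : Mor z z') q :
  coker_map (f + g) q = coker_map f q + coker_map g q.
Proof.
by rewrite -[q]coker_reprK !coker_map_proj cmpDr (raddfD (@coker_proj z)).
Qed.

Definition coker_functor : cofunctor X :=
  @MkCofunctor X coker
    (fun z z' f => coker_map f : {additive coker z' -> coker z})
    coker_map1 coker_map_cmp coker_mapD.

Definition coker_proj_nat : nattrans (representable y) coker_functor :=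
  @MkNattrans X (representable y) coker_functor
    (fun z => @coker_proj z : {additive Mor z y -> coker z})
    (fun z z' f b => esym (coker_map_proj f b)).

Lemma coker_proj_surj z : surj (@coker_proj z).
Proof. by move=> q; exists (coker_repr q); exact: coker_reprK. Qed.

Lemma coker_fin_presented : fin_presented coker_functor.
Proof.
exists x, y, postcomp_nat, coker_proj_nat => z; split.
  exact: coker_proj_surj.
by move=> b; rewrite -(raddf0 (@coker_proj z)) coker_projP subr0.
Qed.

End RepresentableCokernel.

Section Regularity.
Context (X : preadditive).

Lemma representable_fin_presented (y : X) : fin_presented (representable y).
Proof.
have zn : forall z z' (f : Mor z z') (a : Mor z' y),
    (\0 : {additive Mor z y -> Mor z y}) (precomp f a) =
    precomp f (0 : Mor z' y).
  by move=> z z' f a; rewrite raddf0.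
exists y, y.
exists (@MkNattrans X (representable y) (representable y)
  (fun z => \0 : {additive Mor z y -> Mor z y}) zn).
exists (@MkNattrans X (representable y) (representable y)
  (fun z => idfun : {additive Mor z y -> Mor z y}) (fun _ _ _ _ => erefl)) => z.
split=> [b|b]; first by exists b.
by split=> [b0|[c c0]]; [exists 0; exact: esym b0 | exact: esym c0].
Qed.

Lemma surj_epi_mod (F G : cofunctor X) (e : nattrans F G) :
  (forall z, surj (e z)) -> epi_mod e.
Proof.
by move=> se H v w _ evw z b; have [a <-] := se z b; exact: evw.
Qed.

(** A section w of the projection p onto the cokernel of (-, u) makes w p an
    idempotent of (-, y), that is, composition with some q : y -> y.  Since w p
    kills the image of u, q u = 0; since p (1 - w p) = 0, 1 - q = u v for some
    v. *)
Theorem semisimple_mod_regular (x y : X) (u : Mor x y) : semisimple_mod X ->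
  exists v : Mor y x, cmp u (cmp v u) = u.
Proof.
move=> ssX; pose F := coker_functor u; pose p := coker_proj_nat u.
pose idF : nattrans F F := @MkNattrans X F F
  (fun z => idfun : {additive F z -> F z}) (fun _ _ _ _ => erefl).
have [w wP] := ssX F (coker_fin_presented u) _ _ p idF
  (representable_fin_presented y) (coker_fin_presented u)
  (surj_epi_mod (e := p) (@coker_proj_surj _ _ _ u)).
pose q : Mor y y := w y (p y (idm y)).
have qE z (b : Mor z y) : w z (p z b) = cmp q b.
  have := ntrans_natural w b (p y (idm y)).
  by rewrite -(ntrans_natural p) /= /precomp cmp1m => ->.
have [v vP] : exists v, postcomp u v = idm y - q.
  by apply/coker_projP; rewrite [RHS]wP.
exists v; rewrite cmpA -[cmp u v]/(postcomp u v) vP.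
have qu : cmp q u = 0.
  rewrite -qE (_ : p x u = 0) ?raddf0 //= -(raddf0 (@coker_proj _ _ _ u x)).
  by apply/coker_projP; exists (idm x); rewrite subr0 /postcomp cmpm1.
by rewrite cmpBl qu subr0 cmp1m.
Qed.

End Regularity.

(** * Finitely many Gorenstein projectives *)

Section Conclusion.
Context (L : pzRingType).
Hypothesis artinL : artin_algebra L.
Hypothesis cfL : contravariantly_finite (@Gorenstein_projective L).
Hypothesis ssL : G_semisimple L.
Implicit Types M N S T X G : rmodType L.

Lemma stable_regular G X (h : mhom G X) :
    Gorenstein_projective G -> Gorenstein_projective X ->
  exists v : mhom X G, mhom_comp h (mhom_comp v h) - h \in proj_maps G X.
Proof.
move=> gG gX; have [v vP] := @semisimple_mod_regular (stable_Gprj L)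
  (MkGprj gG) (MkGprj gX) (stab h : shom G X) ssL.
pose w : shom X G := v.
have wP : shom_comp (stab h) (shom_comp w (stab h)) = stab h := vP.
by exists (unstab w); apply/stabP; rewrite -!shom_comp_stab unstabK.
Qed.

(** If h v h = h stably, then h (v h)^m = h stably for all m, so v h is not
    nilpotent. *)
Lemma Gprj_summand G X (h : mhom G X) :
    Gorenstein_projective G -> Gorenstein_projective X -> indecomposable G ->
    ~ factors_proj h ->
  summand_of G X.
Proof.
move=> gG gX indG nh; have [v vP] := stable_regular h gG gX.
pose e : {linear G -> G} := mhom_comp v h.
have he m : exists em : mhom G G, (forall x, mhom_fun em x = iter m e x) /\
    mhom_comp h em - h \in proj_maps G X.
  elim: m => [|m [em [emE emP]]].
    exists (mhom_id G); split=> //.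
    by rewrite (_ : mhom_comp h _ = h) ?subrr ?rpred0 //; exact: mhomP.
  exists (mhom_comp (mhom_comp v h) em); split.
    by move=> x; rewrite iterS -emE.
  rewrite (_ : mhom_comp h _ = mhom_comp (mhom_comp h (mhom_comp v h)) em).
    rewrite -[X in X - _](subrK (mhom_comp h em)) -addrA -mhom_compBl.
    by rewrite rpredD // proj_maps_compr.
  exact: mhomP.
exists h, v; have [//|[n n0]] := endo_bijective_or_nilpotent artinL e gG.1 indG.
have [en [enE enP]] := he n; case: nh; apply/proj_mapsP.
suff hen : mhom_comp h en = 0 by rewrite -rpredN -sub0r -hen.
apply: mhomP => x; rewrite /mhom_fun /= -[en x]/(mhom_fun en x) enE n0.
exact: linear0.
Qed.

Lemma finitely_many_Gprj_mapping T : fin_gen T ->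
  finite_up_to_iso (fun G => [/\ Gorenstein_projective G, indecomposable G &
    exists f : {linear G -> T}, ~ factors_proj (f : mhom G T)]).
Proof.
move=> fgT; have [X [g [gX gP]]] := cfL fgT.
apply: finite_up_to_iso_sub (finitely_many_summands artinL gX.1).
move=> G [gG indG [f nf]]; split=> //; first exact: gG.1.
have [h hP] := gP G f gG; apply: (@Gprj_summand _ _ h) => // hF.
apply: nf; rewrite (_ : (f : mhom G T) = (g \o h : {linear G -> T})).
  exact: factors_proj_comp.
exact: mhomP.
Qed.

Lemma finitely_many_Gprj : finite_up_to_iso
  (fun G => Gorenstein_projective G /\ indecomposable G).
Proof.
have [n [T TP]] := finitely_many_simples artinL.
have fin_proj := finitely_many_summands artinL (regular_fin_gen L).
pose C (i : 'I_n) G := [/\ Gorenstein_projective G, indecomposable G &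
  exists S (f : {linear G -> S}),
    [/\ simple S, isomorphic S (T i) & ~ factors_proj (f : mhom G S)]].
have fin_nonproj i : finite_up_to_iso (C i).
  have [[S [simS [r /linear_inverse[s [rK sK]]]]]|noS] :=
    pselect (exists S, simple S /\ isomorphic S (T i)).
    have fgT : fin_gen (T i).
      have [q sq] := simple_regular_quotient simS.
      apply: (fin_gen_surj (f := r \o q : {linear regular L -> T i})).
        exact: regular_fin_gen.
      by move=> t; have [x xP] := sq (s t); exists x; rewrite /= xP sK.
    apply: finite_up_to_iso_sub (finitely_many_Gprj_mapping fgT).
    move=> G [gG indG [S' [f [_ [r' /linear_inverse[s' [rK' _]]] nf]]]].
    split=> //; exists (r' \o f : {linear G -> T i}).
    move=> /(factors_proj_comp s') fF; apply: nf.
    rewrite (_ : (f : mhom G S') = (s' \o (r' \o f) : {linear G -> S'})) //.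
    by apply: mhomP => x; exact: esym (rK' _).
  apply: finite_up_to_iso_sub (finite_up_to_iso0 L) => G.
  by move=> [_ _ [S [f [sS iS _]]]]; apply: noS; exists S.
apply: finite_up_to_iso_sub
  (finite_up_to_isoU fin_proj (finite_up_to_iso_bigcup fin_nonproj)).
move=> G [gG indG]; have [pG|npG] := pselect (fg_projective G).
  by left; split=> //; [exact: gG.1 | exact: projective_summand_regular].
right; have [S [f [simS nf]]] := nonprojective_map_to_simple artinL gG.1 npG.
by have [i iP] := TP S simS; exists i; split=> //; exists S, f.
Qed.

End Conclusion.

Theorem proposition3p4 (L : pzRingType) :
  artin_algebra L ->
  contravariantly_finite (@Gorenstein_projective L) ->
  G_semisimple L ->
  CM_finite L.
Proof.
move=> artinL cfL ssL.
have [n [N NP]] := finitely_many_Gprj artinL cfL ssL.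
have [[M0 gM0]|noG] := pselect (exists M, @Gorenstein_projective L M);
    last first.
  have G0 : 'I_0 -> Gprj L by case.
  by exists 0%N, G0 => M gM; case: noG; exists M.
(* the representatives N i need not be Gorenstein projective themselves *)
have /choice[G GP] : forall i, exists X : Gprj L, forall M,
    Gorenstein_projective M -> isomorphic M (N i) -> isomorphic X (N i).
  move=> i; have [[M [gM MN]]|noM] :=
    pselect (exists M, Gorenstein_projective M /\ isomorphic M (N i)).
    by exists (MkGprj gM).
  by exists (MkGprj gM0) => M gM MN; case: noM; exists M.
exists n, G => M gM indM; have [i MN] := NP M (conj gM indM).
exists i; apply: (isomorphic_trans MN); apply: isomorphic_sym.
exact: GP gM MN.
Qed.
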